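(* Let $F=\breve F(\alpha_1,\dots,\alpha_t)$ be a fence. A basis of $A_T(F)$ is \[ \mathcal B_A(F)=\bigcup_{i=1}^t\{\alpha_i\chi_x+\chi_{s_{i-1}}+\chi_{s_i}: x\in\breve S_i\}, \] and consequently $\dim A_T(F)=\sum_{i=1}^t(\alpha_i-1)$.
   Context: Fences: let $\alpha=(\alpha_1,\dots,\alpha_t)$ be positive integers with $t\ge2$ and $\alpha_1,\alpha_t\ge2$. Put $a_0=0$, $a_i=\alpha_1+\dots+\alpha_i$, $n=a_t-1$. The fence $\breve F(\alpha)$ is the poset on $\{x_1,\dots,x_n\}$ whose cover relations are: for $1\le j\le n-1$ with $a_{i-1}\le j<a_i$, $x_j\lessdot x_{j+1}$ if $i$ is odd and $x_j\gtrdot x_{j+1}$ if $i$ is even. Segments: $S_1=\{x_j:1\le j\le a_1\}$, $S_i=\{x_j:a_{i-1}\le j\le a_i\}$ for $2\le i\le t-1$, $S_t=\{x_j:a_{t-1}\le j\le n\}$. Shared elements are $s_i=x_{a_i}$, $i\in[t-1]$; $\breve S_i$ is the set of non-shared elements of $S_i$. Convention: $\chi_{s_0}$ and $\chi_{s_t}$ are identically zero. $\mathcal J(F)$ is the set of order ideals. For $q\in F$, $I\in\mathcal J(F)$: $\chi_q(I)=1$ if $q\in\max(I)$, else $0$; $T_q(I)=1$ if $q\in\min(F\setminus I)$, $-1$ if $q\in\max(I)$, $0$ otherwise. For $f:\mathcal J(F)\to\mathbb R$, write $f\equiv\text{const}$ if $f=c+\sum_{q\in F}c_qT_q$ for real constants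 $c,c_q$. $A_T(F)=\{f\in\operatorname{Span}_{\mathbb R}\{\chi_q:q\in F\}: f\equiv\text{const}\}$. *)

(* Defs.v *)
From HB Require Import structures.
From mathcomp Require Import all_boot all_order all_algebra.
From mathcomp Require Import reals.
Set Implicit Arguments. Unset Strict Implicit. Unset Printing Implicit Defensive.
Import Order.TTheory GRing.Theory Num.Theory.
Local Open Scope ring_scope.

(* Fence  F(alpha), alpha = [:: alpha_1; ...; alpha_t] : seq nat.
   The element x_j (1 <= j <= n) is represented by the ordinal j-1 : 'I_n. *)
Section Fence.
Variable alpha : seq nat.

Definition fence_t : nat := size alpha.
Definition fence_a (k : nat) : nat := (\sum_(i < k) nth 0 alpha i)%N.
Definition fence_n : nat := (fence_a fence_t).-1.

(* the i (1 <= i <= t) with a_{i-1} <= j < a_i *)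
Definition fence_seg (j : nat) : nat :=
  (\sum_(1 <= k < fence_t.+1) (fence_a k <= j : nat)).+1.

(* cover relation u ⋖ v on the elements; u, v : 'I_n, u = x_(u+1).
   x_j ⋖ x_{j+1} if seg j odd; x_j ⋗ x_{j+1} (i.e. x_{j+1} ⋖ x_j) if seg j even *)
Definition fence_cover : rel 'I_fence_n := fun u v =>
  ((v == u.+1 :> nat) && odd (fence_seg u.+1))
  || ((u == v.+1 :> nat) && ~~ odd (fence_seg v.+1)).

Definition fence_le (u v : 'I_fence_n) : bool := connect fence_cover u v.
Definition fence_lt (u v : 'I_fence_n) : bool := fence_le u v && (u != v).

Definition is_ideal (I : {set 'I_fence_n}) : bool :=
  [forall u, forall v, (fence_le u v && (v \in I)) ==> (u \in I)].

Definition ideals := {I : {set 'I_fence_n} | is_ideal I}.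

Definition in_max (I : {set 'I_fence_n}) (q : 'I_fence_n) : bool :=
  (q \in I) && [forall v, (v \in I) ==> ~~ fence_lt q v].
Definition in_min_compl (I : {set 'I_fence_n}) (q : 'I_fence_n) : bool :=
  (q \notin I) && [forall v, (v \notin I) ==> ~~ fence_lt v q].

Variable R : realType.

Definition fn := {ffun ideals -> R^o}.

Definition chi (q : 'I_fence_n) : fn := [ffun I => (in_max (val I) q)%:R].

Definition Tq (q : 'I_fence_n) : fn :=
  [ffun I => if in_min_compl (val I) q then 1
             else if in_max (val I) q then -1 else 0].

(* chi_{x_j}, for a 1-based index j (0 if x_j does not exist) *)
Definition chiN (j : nat) : fn :=
  if insub j.-1 is Some q then (if (0 < j)%N then chi q else 0) else 0.

(* chi_{s_i}, s_i = x_{a_i} for 1 <= i <= t-1; chi_{s_0} = chi_{s_t} = 0 *)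
Definition chis (i : nat) : fn :=
  if ((0 < i) && (i < fence_t))%N then chiN (fence_a i) else 0.

Definition equiv_const (f : fn) : Prop :=
  exists (c : R) (cq : 'I_fence_n -> R),
    f = [ffun => c] + \sum_(q : 'I_fence_n) cq q *: Tq q.

Definition in_AT (f : fn) : Prop :=
  f \in <<[seq chi q | q <- enum 'I_fence_n]>>%VS /\ equiv_const f.

(* The family B_A(F): for i = 1..t and x = x_j in breve S_i, i.e.
   a_{i-1} < j < a_i (the non-shared elements of S_i),
   alpha_i chi_x + chi_{s_{i-1}} + chi_{s_i}. *)
Definition BA : seq fn :=
  flatten [seq [seq (nth 0 alpha i.-1)%:R *: chiN j + chis i.-1 + chis i
               | j <- iota (fence_a i.-1).+1 (nth 0 alpha i.-1).-1]
          | i <- iota 1 fence_t].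

End Fence.

(* Main.v *)
Require Import Defs.
From HB Require Import structures.
From mathcomp Require Import all_boot all_order all_algebra.
From mathcomp Require Import reals.
From mathcomp Require Import zify ring lra.
Import Order.TTheory GRing.Theory Num.Theory.
Local Open Scope ring_scope.
(** Let [e_j] be the indicator of [x_j \in I], with virtual elements [x_0] and
    [x_(n+1)] added at the two ends. At a non-shared [x_j], the toggle [T_j] is
    the discrete Laplacian [e_(j-1) - 2 e_j + e_(j+1)] and [chi_j] is a difference
    of neighbouring [e]'s; at a shared element, [chi] is [e] (peak) or
    [1 - e - T] (valley). Hence all [chi_x] in a segment agree modulo the [T]'s
    and telescope to the difference of the [e]'s at its ends, which puts the
    claimed basis in [A_T].

    Conversely, modulo the claimed basis an element of [A_T] is a combination of
    the [chi_(s_i)], hence of the [e_(s_i)] modulo toggles and constants. In a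
    relation [\sum_i b_i e_(s_i) = c + \sum_q c_q T_q], the mixed second
    difference in [x_(s-1)], [x_(s+1)] isolates [c_s] for shared [s], so [c_s = 0];
    then adding [x_z] to the ideal strictly below it gives
    [c_(z-1) - 2 c_z + c_(z+1) = 0] for non-shared [z]. Thus [c] is affine on each
    segment and zero at its ends, so [c = 0] and then every [b_i = 0]. *)

(** * Segment boundaries and the direction of each edge *)

Section FenceCombinatorics.
Set Implicit Arguments. Unset Strict Implicit.
Variable alpha : seq nat.
Hypothesis alpha_gt0 : all (fun a => 0 < a)%N alpha.

Local Notation n := (fence_n alpha).
Local Notation t := (fence_t alpha).
Local Notation a := (fence_a alpha).
Local Notation al i := (nth 0%N alpha i).

(** Direction of the edge between [x_j] and [x_(j+1)], true when [x_j] is the lower end. It is also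
    used at j = 0 and j = n, for the edges to the virtual elements. *)
Definition up (j : nat) : bool := odd (fence_seg alpha j).

Lemma fence_a0 : a 0 = 0%N.
Proof. by rewrite /fence_a big_ord0. Qed.

Lemma fence_aS i : a i.+1 = (a i + al i)%N.
Proof. by rewrite /fence_a big_ord_recr. Qed.

Lemma fence_a_le i k : (i <= k)%N -> (a i <= a k)%N.
Proof.
move=> /subnK <-; elim: (k - i)%N => [|d IH] //.
by rewrite addSn fence_aS (leq_trans IH) ?leq_addr.
Qed.

Lemma alpha_pos i : (i < t)%N -> (0 < al i)%N.
Proof. by move=> it; apply: (allP alpha_gt0); rewrite mem_nth. Qed.

Lemma fence_a_lt i k : (i < k)%N -> (k <= t)%N -> (a i < a k)%N.
Proof.
move=> ik kt; apply: leq_trans (fence_a_le ik).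
by rewrite fence_aS -addn1 leq_add2l alpha_pos // (leq_trans ik).
Qed.

Lemma fence_a_inj i k : (i <= t)%N -> (k <= t)%N -> a i = a k -> i = k.
Proof.
move=> it kt e; case: (ltngtP i k) => // h.
  by have := fence_a_lt h kt; rewrite e ltnn.
by have := fence_a_lt h it; rewrite e ltnn.
Qed.

Lemma segment_exists j : (j < a t)%N ->
  exists2 i, (i < t)%N & (a i <= j < a i.+1)%N.
Proof.
suff H k : (k <= t)%N -> (j < a k)%N ->
  exists2 i, (i < t)%N & (a i <= j < a i.+1)%N by apply: H.
elim: k => [|k IH] kt jk; first by rewrite fence_a0 in jk.
 case: (ltnP j (a k)) => h; first by apply: IH => //; apply: ltnW.
by exists k; rewrite ?h.
Qed.

(** Exactly [a 1], ..., [a i] are at most j, so [fence_seg] is i + 1. Segments are numbered from 0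
    here, which accounts for the negation. *)
Lemma upE i j : (i < t)%N -> (a i <= j < a i.+1)%N -> up j = ~~ odd i.
Proof.
move=> it /andP[h1 h2]; rewrite /up /fence_seg.
rewrite (big_cat_nat _ (n := i.+1)) //=; last by rewrite ltnS ltnW.
rewrite [X in (X + _)%N](eq_big_nat _ _ (F2 := fun=> 1%N)); last first.
  move=> k /andP[_ ki]; rewrite (leq_trans _ h1) //.
  by apply: fence_a_le; rewrite -ltnS.
rewrite [X in (_ + X)%N](eq_big_nat _ _ (F2 := fun=> 0%N)); last first.
  move=> k /andP[ki _]; rewrite leqNgt (leq_trans h2) //.
  exact: fence_a_le.
by rewrite big1_eq sum_nat_const_nat subSS subn0 muln1 addn0.
Qed.

Lemma fence_aN : (0 < t)%N -> a t = n.+1.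
Proof.
move=> t0; rewrite /fence_n prednK // -fence_a0.
by apply: fence_a_lt.
Qed.

(** Serves the dimension count: with [fence_aN] it says that the claimed basis and the t - 1 shared
    elements together number n. *)
Lemma sum_pred_alpha : (\sum_(b <- alpha) (b - 1) + t)%N = a t.
Proof.
rewrite /fence_a /fence_t -(big_mkord xpredT (fun i => nth 0%N alpha i)).
rewrite -(big_nth 0%N xpredT id).
elim: alpha alpha_gt0 => [|b s IH] /=; first by rewrite !big_nil.
move=> /andP[b0 /IH {}IH]; rewrite !big_cons; lia.
Qed.

(* Membership of x_j in I, extended by virtual elements x_0 (always in) and
   x_(n+1) (in iff t is even): with these, the end segments obey the same
   formulas as the middle ones. *)
Definition mem_ext (I : {set 'I_n}) (j : nat) : bool :=
  if j is k.+1 then if insub k is Some q then q \in I else ~~ odd t else true.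
Arguments mem_ext : simpl never.

(** Downward closure along every edge j = 0, ..., n, the two virtual edges included. *)
Definition compat (p : nat -> bool) : Prop :=
  forall j, (j <= n)%N -> if up j then p j.+1 -> p j else p j -> p j.+1.

Lemma mem_extS I (q : 'I_n) : mem_ext I q.+1 = (q \in I).
Proof. by rewrite /mem_ext valK. Qed.

Lemma mem_ext_out I j : (n < j)%N -> mem_ext I j = ~~ odd t.
Proof. by case: j => // j nj; rewrite /mem_ext insubF // ltnNge -ltnS nj. Qed.

Lemma up0 : (0 < t)%N -> up 0.
Proof.
move=> t0; rewrite (@upE 0) // fence_a0 /=.
by rewrite -[X in (X < _)%N]fence_a0 fence_a_lt.
Qed.

(** This direction fits the value chosen for [x_(n+1)]: for odd t it lies above [x_n] and is out,
    for even t it lies below and is in. So the last edge never constrains an ideal. *)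
Lemma upn : (0 < t)%N -> up n = odd t.
Proof.
move=> t0; have e : t = t.-1.+1 by rewrite prednK.
rewrite [X in odd X]e /=; apply: upE; rewrite -?e // fence_aN // ltnSn andbT.
by rewrite -ltnS -fence_aN // fence_a_lt // -e.
Qed.

(** * Ideals, maxima and complement minima read off from neighbours *)

Lemma fence_coverE (u v : 'I_n) : fence_cover u v =
  (v == u.+1 :> nat) && up u.+1 || (u == v.+1 :> nat) && ~~ up v.+1.
Proof. by []. Qed.

Lemma cover_lt (u v : 'I_n) : fence_cover u v -> fence_lt u v.
Proof.
move=> uv; rewrite /fence_lt /fence_le connect1 //=.
apply: contraTneq uv => ->; rewrite fence_coverE.
by rewrite ltn_eqF.
Qed.

Lemma is_idealP (I : {set 'I_n}) :
  reflect (forall u v : 'I_n, fence_cover u v -> v \in I -> u \in I) (is_ideal I).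
Proof.
apply: (iffP idP) => [h u v uv vI | h].
  move/forallP: h => /(_ u) /forallP /(_ v) /implyP; apply.
  by rewrite vI andbT /fence_le connect1.
apply/forallP => u; apply/forallP => v; apply/implyP => /andP[/connectP[p]].
elim: p u => [|w p IH] u /=; first by move=> _ ->.
by move=> /andP[uw pw] e vI; apply: (h _ _ uw); apply: IH pw e vI.
Qed.

Lemma ideal_le {I : {set 'I_n}} (u v : 'I_n) :
  is_ideal I -> fence_le u v -> v \in I -> u \in I.
Proof.
move=> /forallP /(_ u) /forallP /(_ v) /implyP h uv vI.
by apply: h; rewrite uv.
Qed.

Lemma compat_ideal (I : {set 'I_n}) : (0 < t)%N -> is_ideal I -> compat (mem_ext I).
Proof.
move=> t0 /is_idealP h [|j]; first by rewrite up0.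
rewrite leq_eqVlt => /orP[/eqP e|jn].
  by rewrite {1 2 5}e mem_ext_out // upn //; case: (odd t).
rewrite -[j.+1]/((Ordinal (ltnW jn)).+1) -[j.+2]/((Ordinal jn).+1) !mem_extS.
case: ifP => /= uj; apply: h; rewrite fence_coverE /= eqxx uj //.
by rewrite orbT.
Qed.

Lemma ideal_of_compat (p : nat -> bool) :
  compat p -> is_ideal [set q : 'I_n | p q.+1].
Proof.
move=> h; apply/is_idealP => u v; rewrite !inE fence_coverE.
move=> /orP[/andP[/eqP e uu]|/andP[/eqP e uu]].
  by have := h u.+1 (ltn_ord u); rewrite uu e.
by have := h v.+1 (ltn_ord v); rewrite (negPf uu) e.
Qed.

Lemma in_maxP (I : {set 'I_n}) (q : 'I_n) : is_ideal I ->
  reflect (q \in I /\ forall v, fence_cover q v -> v \notin I) (in_max I q).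
Proof.
move=> hI; apply: (iffP andP) => -[qI h]; split => //.
  move=> v qv; apply/negP => vI.
  by move/forallP: h => /(_ v); rewrite vI cover_lt.
apply/forallP => v; apply/implyP => vI; apply/negP => /andP[/connectP[[|w p] /=]].
  by move=> _ ->; rewrite eqxx.
move=> /andP[qw pw] e _; apply/negP: (h _ qw); rewrite negbK.
by apply: (ideal_le hI _ vI); apply/connectP; exists p.
Qed.

Lemma in_min_complP (I : {set 'I_n}) (q : 'I_n) : is_ideal I ->
  reflect (q \notin I /\ forall v, fence_cover v q -> v \in I) (in_min_compl I q).
Proof.
move=> hI; apply: (iffP andP) => -[qI h]; split => //.
  move=> v vq; apply: contraT => vI.
  by move/forallP: h => /(_ v); rewrite vI cover_lt.
apply/forallP => v; apply/implyP => vI; apply/negP => /andP[/connectP[p]].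
case/lastP: p => [|p w] /=; first by move=> _ ->; rewrite eqxx.
rewrite rcons_path last_rcons => /andP[pw wq] e _; subst w.
apply/negP: vI; rewrite negbK.
by apply: (ideal_le hI _ (h _ wq)); apply/connectP; exists p.
Qed.

Definition max_at (e : nat -> bool) (j : nat) : bool :=
  [&& e j, up j ==> ~~ e j.+1 & ~~ up j.-1 ==> ~~ e j.-1].
Definition min_at (e : nat -> bool) (j : nat) : bool :=
  [&& ~~ e j, up j.-1 ==> e j.-1 & ~~ up j ==> e j.+1].

(** Maximality needs testing only against upper covers, which are neighbours. At an end of the fence
    the test against the virtual neighbour holds automatically. *)
Lemma in_maxE (I : {set 'I_n}) (q : 'I_n) : (0 < t)%N -> is_ideal I ->
  in_max I q = max_at (mem_ext I) q.+1.
Proof.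
move=> t0 hI; apply/in_maxP/and3P => //; rewrite mem_extS.
  move=> [qI h]; split => //; apply/implyP => uq.
    have:= ltn_ord q; rewrite leq_eqVlt => /orP[/eqP e|qn].
      by rewrite {1}e mem_ext_out // negbK -upn // -e.
    rewrite -[q.+2]/((Ordinal qn).+1) mem_extS; apply: h.
    by rewrite fence_coverE /= eqxx uq.
  case: q {qI} h uq => [[|q] qn] /= h uq; first by rewrite up0 in uq.
  rewrite -[q.+1]/((Ordinal (ltnW qn)).+1) mem_extS; apply: h.
  by rewrite fence_coverE /= eqxx uq orbT.
move=> [qI h1 h2]; split => // v; rewrite fence_coverE.
move=> /orP[/andP[/eqP e uq]|/andP[/eqP e uq]].
  by move: h1; rewrite uq -e mem_extS.
by move: h2; rewrite e /= uq mem_extS.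
Qed.

Lemma in_min_complE (I : {set 'I_n}) (q : 'I_n) : (0 < t)%N -> is_ideal I ->
  in_min_compl I q = min_at (mem_ext I) q.+1.
Proof.
move=> t0 hI; apply/in_min_complP/and3P => //; rewrite mem_extS.
  move=> [qI h]; split => //; apply/implyP => uq.
    case: q {qI} h uq => [[|q] qn] //= h uq.
    rewrite -[q.+1]/((Ordinal (ltnW qn)).+1) mem_extS; apply: h.
    by rewrite fence_coverE /= eqxx uq.
  have:= ltn_ord q; rewrite leq_eqVlt => /orP[/eqP e|qn].
    by rewrite {1}e mem_ext_out // -upn // -e.
  rewrite -[q.+2]/((Ordinal qn).+1) mem_extS; apply: h.
  by rewrite fence_coverE /= eqxx uq orbT.
move=> [qI h1 h2]; split => // v; rewrite fence_coverE.
move=> /orP[/andP[/eqP e uq]|/andP[/eqP e uq]].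
  by move: h1; rewrite e /= uq mem_extS.
by move: h2; rewrite uq -e mem_extS.
Qed.

End FenceCombinatorics.

Arguments mem_ext : simpl never.

(** * Toggles and [chi] as expressions in neighbouring indicators *)

Section FenceFunctions.
Set Implicit Arguments. Unset Strict Implicit.
Variables (R : realType) (alpha : seq nat).
Hypothesis alpha_gt0 : all (fun a => 0 < a)%N alpha.
Hypothesis t_ge2 : (2 <= size alpha)%N.

Local Notation n := (fence_n alpha).
Local Notation t := (fence_t alpha).
Local Notation a := (fence_a alpha).
Local Notation al i := (nth 0%N alpha i).
Local Notation up := (up alpha).
Local Notation mem_ext := (@mem_ext alpha).
Local Notation compat := (compat alpha).

Lemma t_gt0 : (0 < t)%N.
Proof. exact: ltnW t_ge2. Qed.
Local Hint Resolve t_gt0 : core.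

Lemma up_interior i j : (i < t)%N -> (a i < j < a i.+1)%N ->
  up j.-1 = ~~ odd i /\ up j = ~~ odd i.
Proof.
clear alpha_gt0 t_ge2.
by move=> it /andP[h1 h2]; split; apply: upE => //; lia.
Qed.

Lemma up_shared i : (0 < i < t)%N -> up (a i).-1 = odd i /\ up (a i) = ~~ odd i.
Proof.
clear t_ge2; case: i => // i /andP[_ it]; split; last first.
  by apply: upE => //; rewrite leqnn fence_a_lt.
have := fence_a_lt alpha_gt0 (ltnSn i) (ltnW it).
by move=> h; apply: (upE (ltnW it)); lia.
Qed.

Definition tau (e : nat -> bool) (j : nat) : R :=
  if min_at alpha e j then 1 else if max_at alpha e j then -1 else 0.

Lemma tau_local e e' j : e j.-1 = e' j.-1 -> e j = e' j -> e j.+1 = e' j.+1 ->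
  tau e j = tau e' j.
Proof. by rewrite /tau /min_at /max_at => -> -> ->. Qed.

Lemma TqE (q : 'I_n) (I : ideals alpha) : Tq R q I = tau (mem_ext (val I)) q.+1.
Proof.
by rewrite ffunE /tau (in_maxE alpha_gt0) ?(in_min_complE alpha_gt0) //; apply: (valP I).
Qed.

Lemma chiE (q : 'I_n) (I : ideals alpha) :
  chi R q I = (max_at alpha (mem_ext (val I)) q.+1)%:R.
Proof. by rewrite ffunE (in_maxE alpha_gt0) //; apply: (valP I). Qed.

(** Both edges at j point the same way, so compatibility makes [e] monotone on j - 1, j, j + 1. Only
    four patterns survive, and the formula is checked on each. *)
Lemma tau_chain e j : (j <= n)%N -> (0 < j)%N -> compat e -> up j.-1 = up j ->
  tau e j = (e j.-1)%:R - 2 * (e j)%:R + (e j.+1)%:R.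
Proof.
case: j => // j jn _ he /= u; have := he j (ltnW jn); have := he j.+1 jn.
rewrite /tau /min_at /max_at /= u; case: (up j.+1);
case: (e j); case: (e j.+1); case: (e j.+2) => //= h1 h2;
  by [case: (h1 isT) | case: (h2 isT) | lra].
Qed.

Lemma max_chain e j : (j <= n)%N -> (0 < j)%N -> compat e -> up j.-1 = up j ->
  (max_at alpha e j)%:R = (if up j then (e j)%:R - (e j.+1)%:R
                     else (e j)%:R - (e j.-1)%:R) :> R.
Proof.
case: j => // j jn _ he /= u; have := he j (ltnW jn); have := he j.+1 jn.
rewrite /max_at /= u; case: (up j.+1);
case: (e j); case: (e j.+1); case: (e j.+2) => //= h1 h2;
  by [case: (h1 isT) | case: (h2 isT) | lra].
Qed.

Lemma max_peak e j : up j.-1 -> ~~ up j -> max_at alpha e j = e j.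
Proof. by rewrite /max_at => -> /negPf ->; rewrite /= andbT. Qed.

(** A valley is minimal in the fence: when it is out, its toggle is 1; when it is in, its toggle is
    minus the maximality indicator. *)
Lemma max_valley e j : (j <= n)%N -> (0 < j)%N -> compat e -> ~~ up j.-1 -> up j ->
  (max_at alpha e j)%:R = 1 - (e j)%:R - tau e j.
Proof.
case: j => // j jn _ he /= u v; have := he j (ltnW jn); have := he j.+1 jn.
rewrite /tau /min_at /max_at /= v (negPf u) /=.
case: (e j); case: (e j.+1); case: (e j.+2) => //= h1 h2;
  by [case: (h1 isT) | case: (h2 isT) | lra].
Qed.

(** * Ideals built from compatible patterns, in particular principal ideals *)

Definition ext (p : nat -> bool) (j : nat) : bool :=
  if j == 0%N then true else if (j <= n)%N then p j else ~~ odd t.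

Definition ideal_of (p : nat -> bool) (hp : compat p) : ideals alpha :=
  exist (fun I => is_ideal I) _ (ideal_of_compat hp).

(** [ext] overrides [p] by the virtual values at 0 and beyond n, so the two sides agree whatever [p]
    is there. *)
Lemma mem_ideal_of p (hp : compat p) j : mem_ext (val (ideal_of hp)) j = ext p j.
Proof.
case: j => // j; rewrite /ext /=; case: ltnP => jn.
  by rewrite -[j.+1]/((Ordinal jn).+1) mem_extS inE.
by rewrite mem_ext_out.
Qed.

(** The order relation from [x_j] up to [x_z]: the edges between them must all climb towards z. *)
Definition below (z j : nat) : bool :=
  if (j <= z)%N then all up (iota j (z - j)) else ~~ has up (iota z (j - z)).

(* principal true z and principal false z: the principal ideal of x_z with and
   without x_z itself. *)
Definition principal (b : bool) (z j : nat) : bool := below z j && (b || (j != z)).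

Lemma below_lt z j : (j < z)%N -> below z j = up j && below z j.+1.
Proof.
by move=> jz; rewrite /below jz (ltnW jz) -[(z - j)%N]prednK ?subn_gt0 // -subnS.
Qed.

Lemma below_ge z j : (z <= j)%N -> below z j.+1 = ~~ up j && below z j.
Proof.
move=> zj; rewrite /below ltnNge zj /= subSn // -[X in iota z X]addn1 iotaD has_cat.
rewrite subnKC //= orbF negb_or andbC; congr (_ && _).
by case: ltngtP zj => // ->; rewrite subnn.
Qed.

Lemma belowS z j : if up j then below z j.+1 -> below z j
  else below z j -> below z j.+1.
Proof.
by case: (ltnP j z) => h; rewrite ?(below_lt h) ?(below_ge h); case: (up j).
Qed.

Lemma compat_principal b z : compat (principal b z).
Proof.
move=> j _; have := belowS z j; rewrite /principal; case: b; rewrite /= ?andbT //.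
(* Deleting z can only break closure along an edge from z up to an element below z, and [below]
   rules such an edge out. *)
case: ifP => u h /andP[h1 h2]; rewrite h //=; apply: contraTneq h1 => e.
  by rewrite -e /below ltnn subSn // subnn /= u.
by rewrite /below -e leqnSn subSn // subnn /= u.
Qed.

Lemma compat_or p q : compat p -> compat q -> compat (fun j => p j || q j).
Proof.
move=> hp hq j jn; have := hp j jn; have := hq j jn; case: ifP => _ h1 h2;
by move=> /orP[/h2|/h1] ->; rewrite ?orbT.
Qed.

Lemma principal_self b z : principal b z z = b.
Proof. by rewrite /principal /below leqnn subnn eqxx orbF. Qed.

Lemma principal_other b z j : j != z -> principal b z j = below z j.
Proof. by rewrite /principal => ->; rewrite orbT andbT. Qed.

(** At a turning point the two neighbours are incomparable; s lies under both if it is a valley and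
    under neither if it is a peak. *)
Lemma below_around s : up s.-1 != up s -> (0 < s)%N ->
  [/\ below s.-1 s.+1 = false, below s.+1 s.-1 = false,
      below s.-1 s = ~~ up s.-1 & below s.+1 s = up s].
Proof.
case: s => // s; rewrite /below /= => h _.
have [-> -> -> ->] : [/\ (s.+2 <= s)%N = false, (s <= s.+2)%N,
    (s.+1 <= s)%N = false & (s.+1 <= s.+2)%N] by split; lia.
have [-> -> ->] : [/\ s.+2 - s = 2, s.+1 - s = 1 & s.+2 - s.+1 = 1]%N by split; lia.
rewrite /= !orbF !andbT.
by case: (up s) h; case: (up s.+1).
Qed.


(** * Independence of the shared indicators modulo constants and toggles *)

Hypothesis alpha_head : (2 <= head 0 alpha)%N.
Hypothesis alpha_last : (2 <= last 0 alpha)%N.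

(** The end segments have length at least 2, so both neighbours of a shared element are genuine
    elements of the fence. *)
Lemma shared_bounds i : (0 < i < t)%N -> (1 < a i < n)%N.
Proof.
move=> /andP[i0 it]; apply/andP; split.
  apply: leq_trans (fence_a_le alpha i0); rewrite fence_aS fence_a0 add0n.
  by rewrite nth0.
have tE : t = t.-1.+1 by rewrite prednK.
have := fence_aN alpha_gt0 t_gt0; rewrite tE fence_aS.
have : (1 < al t.-1)%N by rewrite nth_last.
have : (a i <= a t.-1)%N by apply: fence_a_le; rewrite -ltnS -tE.
lia.
Qed.

Definition ind (j : nat) : fn alpha R := [ffun I => (mem_ext (val I) j)%:R].

Section Key.
Variables (b : nat -> R) (c : R) (cq : 'I_n -> R).
Hypothesis relation : \sum_(i < t.-1) b i *: ind (a i.+1) =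
  [ffun=> c] + \sum_(q : 'I_n) cq q *: Tq R q.

Lemma relation_eval p : compat p ->
  \sum_(i < t.-1) b i * (ext p (a i.+1))%:R =
  c + \sum_(q : 'I_n) cq q * tau (ext p) q.+1.
Proof.
move=> hp; have := congr1 (fun f : fn alpha R => f (ideal_of hp)) relation.
rewrite ffunE !sum_ffunE !ffunE => h.
transitivity (\sum_(i < t.-1) (b i *: ind (a i.+1)) (ideal_of hp)).
  by apply: eq_bigr => i _; rewrite !ffunE mem_ideal_of.
rewrite h; congr (_ + _); apply: eq_bigr => q _; rewrite ffunE TqE.
by congr (_ * _); apply: tau_local; rewrite mem_ideal_of.
Qed.

(** The neighbours of s can be put in or left out independently with all else fixed. Every term
    other than the toggle at s sees at most one of them, so it has zero mixed second difference. *)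
Lemma coef_shared (q : 'I_n) : (1 < q.+1 < n)%N -> up q != up q.+1 -> cq q = 0.
Proof.
set s := q.+1 => /andP[s1 sn] us.
have [b1 b2 b3 b4] := below_around us isT.
(* Union of the principal ideals of the two neighbours, each with its top kept or removed; s itself
   belongs to it exactly when it is a valley. *)
pose p x y j := principal x s.-1 j || principal y s.+1 j.
have hp x y : compat (p x y) by apply: compat_or; apply: compat_principal.
have p1 x y : ext (p x y) s.-1 = x.
  rewrite /ext ifF; last by lia. rewrite ifT; last by lia.
  by rewrite /p principal_self principal_other ?b2 ?orbF //; lia.
have p2 x y : ext (p x y) s.+1 = y.
  rewrite /ext /= sn /p principal_self principal_other ?b1 //; lia.
have ps x y : ext (p x y) s = up s.
  rewrite /ext /= ifT; last by lia.
  rewrite /p !principal_other; try by clear; lia.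
  by rewrite b3 b4; move: us; rewrite /s /=; case: (up q); case: (up q.+1).
have px x x' y j : j != s.-1 -> ext (p x y) j = ext (p x' y) j.
  by move=> h; rewrite /ext /p !(principal_other _ h).
have py x y y' j : j != s.+1 -> ext (p x y) j = ext (p x y') j.
  by move=> h; rewrite /ext /p !(principal_other _ h).
pose D (f : bool -> bool -> R) := f true true - f true false - f false true + f false false.
have D0x f : (forall y, f true y = f false y) -> D f = 0.
  by move=> h; rewrite /D !h; ring.
have D0y f : (forall x, f x true = f x false) -> D f = 0.
  by move=> h; rewrite /D !h; ring.
have hD : D (fun x y => \sum_(i < t.-1) b i * (ext (p x y) (a i.+1))%:R) =
          D (fun x y => c + \sum_(r : 'I_n) cq r * tau (ext (p x y)) r.+1).
  by rewrite /D !(relation_eval (hp _ _)).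
have L : D (fun x y => \sum_(i < t.-1) b i * (ext (p x y) (a i.+1))%:R) = 0.
  rewrite /D -!sumrB -big_split /=; apply: big1 => i _.
  rewrite -[LHS]/(D (fun x y => b i * (ext (p x y) (a i.+1))%:R)).
  have [e|ne] := eqVneq (a i.+1) s.-1.
    by apply: D0y => x; rewrite (py _ _ false) // e; lia.
  by apply: D0x => y; rewrite (px _ false).
have Rr : D (fun x y => c + \sum_(r : 'I_n) cq r * tau (ext (p x y)) r.+1) =
          cq q * D (fun x y => tau (ext (p x y)) s).
  rewrite {1}/D.
  have E4 (u x y z w : R) : u + x - (u + y) - (u + z) + (u + w) = x - y - z + w by ring.
  rewrite E4 -!sumrB -big_split /= (bigD1 q) //= big1 ?addr0; last first.
    move=> r rq.
    rewrite -[LHS]/(D (fun x y => cq r * tau (ext (p x y)) r.+1)).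
    have rs : r.+1 != s by rewrite eqSS.
    (* For r + 1 other than s, the window r, r + 1, r + 2 misses s - 1 or s + 1. *)
    have [h|h] := boolP [&& r.+1.-1 != s.-1, r.+1 != s.-1 & r.+2 != s.-1].
      case/and3P: h => h1 h2 h3; apply: D0x => y; congr (_ * _).
      by apply: tau_local; apply: px.
    apply: D0y => x; congr (_ * _).
    by apply: tau_local; apply: py; clear -rs h; lia.
  by rewrite /D; ring.
move: hD; rewrite L Rr => /esym /eqP; rewrite mulf_eq0 => /orP[/eqP //|].
(* At a peak the toggle is 1 only with both neighbours in; at a valley it is -1 only with both out.
   So its mixed difference is 1 or -1. *)
rewrite /D /tau /min_at /max_at !p1 !p2 !ps.
by move: us; rewrite /s /=; case: (up q); case: (up q.+1) => //= _ /eqP h; exfalso; lra.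
Qed.

(** The value 0 at index 0 and beyond n gives the end segments the same boundary condition as the
    shared elements. *)
Definition coefN (j : nat) : R :=
  if j is k.+1 then if insub k is Some q then cq q else 0 else 0.

Lemma coefNS (q : 'I_n) : coefN q.+1 = cq q.
Proof. by rewrite /coefN valK. Qed.

Lemma coefN_out j : (n < j)%N -> coefN j = 0.
Proof. by case: j => // j nj; rewrite /coefN insubF // ltnNge -ltnS nj. Qed.

Lemma sum_coefN m : \sum_(q : 'I_n) cq q * (q.+1 == m)%:R = coefN m.
Proof.
case: m => [|m]; first by rewrite big1 // => q _; rewrite mulr0.
case: (ltnP m n) => mn.
  rewrite -[m.+1]/((Ordinal mn).+1) coefNS (bigD1 (Ordinal mn)) //= eqxx mulr1.
  rewrite big1 ?addr0 // => q qm; rewrite eqSS.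
  by rewrite -[m]/(nat_of_ord (Ordinal mn)) val_eqE (negPf qm) mulr0.
rewrite coefN_out ?ltnS // big1 // => q _.
by rewrite eqSS ltn_eqF ?mulr0 // (leq_trans (ltn_ord q)).
Qed.

Lemma coefN_shared i : (0 < i < t)%N -> coefN (a i) = 0.
Proof.
move=> it; have [u1 u2] := up_shared it; have := shared_bounds it.
case ei: (a i) u1 u2 => [|k] // u1 u2 /andP[k1 kn].
rewrite -[k.+1]/((Ordinal (ltnW kn)).+1) coefNS.
by apply: coef_shared; rewrite /= ?k1 ?u1 ?u2 //; case: (odd i).
Qed.

(** Adding [x_z] to the ideal strictly below it changes only [e_z]. Toggles at turning points
    already have coefficient 0 and the others are Laplacians, so by symmetry the right side changes
    by the Laplacian of the coefficients at z. *)
Lemma coefN_harmonic z : (0 < z <= n)%N ->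
  \sum_(i < t.-1) b i * (a i.+1 == z)%:R =
  coefN z.-1 - 2 * coefN z + coefN z.+1.
Proof.
move=> /andP[z0 zn].
have h1 := relation_eval (compat_principal true z).
have h0 := relation_eval (compat_principal false z).
have ee j : (ext (principal true z) j)%:R - (ext (principal false z) j)%:R = (j == z)%:R :> R.
  have [->|ne] := eqVneq j z.
    by rewrite /ext gtn_eqF // zn !principal_self subr0.
  by rewrite /ext !(principal_other _ ne) subrr.
transitivity (\sum_(i < t.-1) b i * (ext (principal true z) (a i.+1))%:R -
  \sum_(i < t.-1) b i * (ext (principal false z) (a i.+1))%:R).
  by rewrite -sumrB; apply: eq_bigr => i _; rewrite -mulrBr ee.
rewrite h1 h0 opprD addrACA subrr add0r -sumrB.
rewrite -!sum_coefN mulr_sumr -sumrB -big_split /=; apply: eq_bigr => q _.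
(* If the two edges disagree, [x_(q+1)] is shared and its coefficient vanishes; otherwise
   [tau_chain] applies. *)
have [us|/eqP us] := eqVneq (up q) (up q.+1); last first.
  suff -> : cq q = 0 by rewrite !mul0r; ring.
  have [i it /andP[i1 i2]] : exists2 i, (i < t)%N & (a i <= q.+1 < a i.+1)%N.
    by apply: segment_exists; rewrite fence_aN // ltnS ltn_ord.
  rewrite -coefNS; move: i1; rewrite leq_eqVlt => /orP[/eqP e|i1].
    by rewrite -e coefN_shared // it andbT; case: i e {i2 it} => //; rewrite fence_a0.
  have [e1 e2] := @up_interior i q.+1 it (introT andP (conj i1 i2)).
  by case: us; rewrite e2 -e1.
have hc x : compat (ext (principal x z)).
  move=> j jn.
  have := compat_ideal alpha_gt0 t_gt0 (valP (ideal_of (compat_principal x z))) jn.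
  by rewrite !mem_ideal_of.
rewrite !tau_chain //= -mulrBr.
have -> : (q.+1 == z.-1)%:R = (q.+2 == z)%:R :> R by congr (_%:R : R); lia.
have -> : (q.+1 == z.+1)%:R = (nat_of_ord q == z)%:R :> R by congr (_%:R : R); lia.
rewrite -!ee; ring.
Qed.

Lemma coefN0 j : (j < a t)%N -> coefN j = 0.
Proof.
move=> jt; have [i it /andP[i1 i2]] := segment_exists jt.
have b0 : coefN (a i) = 0.
  case: (posnP i) => [->|i0]; first by rewrite fence_a0.
  by apply: coefN_shared; rewrite i0.
have b1 : coefN (a i.+1) = 0.
  have [e|ne] := eqVneq i.+1 t; first by rewrite e coefN_out // fence_aN.
  by apply: coefN_shared; rewrite [in X in _ && X]ltn_neqAle ne.
have step z : (a i < z < a i.+1)%N -> coefN z.-1 - 2 * coefN z + coefN z.+1 = 0.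
  move=> /andP[z1 z2]; rewrite -coefN_harmonic; last first.
    have := fence_a_le alpha it; rewrite fence_aN //; lia.
  apply: big1 => k _; case: eqP => [e|]; last by rewrite mulr0.
  move: z1 z2; rewrite -e => z1 z2.
  have : (i < k.+1)%N by rewrite ltnNge; apply/negP => /(fence_a_le alpha); lia.
  have : (k.+1 < i.+1)%N by rewrite ltnNge; apply/negP => /(fence_a_le alpha); lia.
  lia.
(* Two consecutive values are carried because the recurrence is of second order. The slope is then
   0, as the value at [a i.+1] is. *)
have lin k : (a i + k < a i.+1)%N ->
    coefN (a i + k) = k%:R * coefN (a i).+1 /\
    coefN (a i + k).+1 = k.+1%:R * coefN (a i).+1.
  elim: k => [|k IH] h; first by rewrite addn0 b0 mul0r mul1r.
  have [|h1 h2] := IH; first by lia.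
  rewrite addnS; split; first exact: h2.
  have := @step (a i + k).+1; rewrite h1 h2 /= -![_.+1%:R]natr1 => st.
  by have := st ltac:(lia) => {}st; lra.
have d0 : coefN (a i).+1 = 0.
  have ai : (0 < al i)%N by apply: alpha_pos.
  have [_] := lin (al i).-1 ltac:(rewrite fence_aS; lia).
  rewrite -addnS prednK // -fence_aS b1 => /esym/eqP.
  by rewrite mulf_eq0 pnatr_eq0 gtn_eqF //= => /eqP.
have [] := lin (j - a i)%N ltac:(lia).
by rewrite subnKC // d0 mulr0.
Qed.

(** Once all toggle coefficients vanish, [coefN_harmonic] at the shared index [a i.+1] has only
    [b i] left. *)
Lemma relation_trivial (i : 'I_(t.-1)) : b i = 0.
Proof.
have it : (0 < i.+1 < t)%N by have := ltn_ord i; have := t_ge2; rewrite /fence_t; lia.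
have /andP[s1 sn] := shared_bounds it.
have h := @coefN_harmonic (a i.+1) ltac:(lia).
rewrite !coefN0 ?fence_aN // in h; try lia.
rewrite (bigD1 i) //= eqxx mulr1 big1 in h.
  by rewrite addr0 in h; rewrite h; ring.
move=> k ki; case: eqP => [e|]; last by rewrite mulr0.
have kt := ltn_ord k.
case/eqP: ki; apply/val_inj/succn_inj => /=.
by apply: (fence_a_inj alpha_gt0 _ _ e); lia.
Qed.

End Key.

End FenceFunctions.

(** * Functions modulo constants and toggles; the claimed basis lies in [A_T] *)

Section Main.
Set Implicit Arguments. Unset Strict Implicit.
Variables (R : realType) (alpha : seq nat).
Hypothesis alpha_gt0 : all (fun a => 0 < a)%N alpha.
Hypothesis t_ge2 : (2 <= size alpha)%N.
Hypothesis alpha_head : (2 <= head 0 alpha)%N.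
Hypothesis alpha_last : (2 <= last 0 alpha)%N.

Local Notation n := (fence_n alpha).
Local Notation t := (fence_t alpha).
Local Notation a := (fence_a alpha).
Local Notation al i := (nth 0%N alpha i).
Local Notation up := (up alpha).
Local Notation mem_ext := (@mem_ext alpha).
Local Notation compat := (compat alpha).
Local Notation ind := (ind R alpha).
Local Notation chiN := (chiN alpha R).
Local Notation chis := (chis alpha R).
Local Notation fn := (fn alpha R).
Local Notation ec := (@equiv_const alpha R).

Definition cst (c : R) : fn := [ffun=> c].

Lemma ec_cst c : ec (cst c).
Proof.
exists c, (fun=> 0); rewrite big1 ?addr0 // => q _; exact: scale0r.
Qed.

Lemma ec0 : ec 0.
Proof. by have := ec_cst 0; congr ec; apply/ffunP => I; rewrite !ffunE. Qed.

Lemma ecD f g : ec f -> ec g -> ec (f + g).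
Proof.
move=> [c [u ->]] [d [v ->]]; exists (c + d), (fun q => u q + v q).
rewrite addrACA; congr (_ + _); first by apply/ffunP => I; rewrite !ffunE.
by rewrite -big_split /=; apply: eq_bigr => q _; rewrite scalerDl.
Qed.

Lemma ecZ k f : ec f -> ec (k *: f).
Proof.
move=> [c [u ->]]; exists (k * c), (fun q => k * u q).
rewrite scalerDr; congr (_ + _); first by apply/ffunP => I; rewrite !ffunE.
by rewrite scaler_sumr; apply: eq_bigr => q _; rewrite scalerA.
Qed.

Lemma ecN f : ec f -> ec (- f).
Proof. by rewrite -scaleN1r; apply: ecZ. Qed.

Lemma ecB f g : ec f -> ec g -> ec (f - g).
Proof. by move=> hf hg; apply: ecD => //; apply: ecN. Qed.

Lemma ec_sum (I : Type) (r : seq I) (P : pred I) (F : I -> fn) :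
  (forall i, P i -> ec (F i)) -> ec (\sum_(i <- r | P i) F i).
Proof. by move=> h; apply: big_ind => //; [exact: ec0 | exact: ecD]. Qed.

Lemma ec_Tq (q : 'I_n) : ec (Tq R q).
Proof.
exists 0, (fun r => (r == q)%:R); rewrite (bigD1 q) //= eqxx scale1r.
rewrite big1 => [|r /negPf ->]; last exact: scale0r.
by rewrite addr0; apply/ffunP => I; rewrite !ffunE add0r.
Qed.

Lemma chiNE (q : 'I_n) : chiN q.+1 = chi R q.
Proof. by rewrite /Defs.chiN /= valK. Qed.

Lemma chiN_at j I : (0 < j <= n)%N ->
  chiN j I = (max_at alpha (mem_ext (val I)) j)%:R.
Proof.
case: j => // j jn; rewrite -[j.+1]/((Ordinal jn).+1) chiNE.
exact: chiE.
Qed.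

Definition TN (j : nat) : fn := [ffun I => tau R alpha (mem_ext (val I)) j].

Lemma ec_TN j : (0 < j <= n)%N -> ec (TN j).
Proof.
case: j => // j jn; have := ec_Tq (Ordinal jn); congr ec.
by apply/ffunP => I; rewrite TqE // ffunE.
Qed.

Lemma compat_mem (I : ideals alpha) : compat (mem_ext (val I)).
Proof. by apply: compat_ideal => //; [exact: ltnW | exact: valP]. Qed.

(** Odd i gives a peak and even i a valley. At i = 0 and i = t both sides are zero, thanks to the
    values of the virtual elements. *)
Lemma chis_mod i : (i <= t)%N ->
  ec (chis i - (if odd i then ind (a i) else cst 1 - ind (a i))).
Proof.
move=> it; rewrite /Defs.chis; case: (posnP i) => [->|i0].
  have := ec0; congr ec; apply/ffunP => I.
  by rewrite fence_a0 !ffunE (_ : mem_ext _ 0 = true) // subrr subr0.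
move: it; rewrite leq_eqVlt => /orP[/eqP e|it].
  have := ec0; congr ec; apply/ffunP => I.
  rewrite e ltnn andbF fence_aN // -?e //; case: ifP => oi; rewrite !ffunE /=;
    by rewrite mem_ext_out // -e oi /= ?subrr ?subr0.
rewrite it /=; have it' : (0 < i < t)%N by rewrite i0.
have [u1 u2] := up_shared alpha_gt0 it'.
have sb : (0 < a i <= n)%N.
  by have := shared_bounds alpha_gt0 t_ge2 alpha_head alpha_last it'; lia.
have /andP[sb1 sb2] := sb.
case: ifP => oi; rewrite oi in u1 u2.
  have := ec0; congr ec; apply/ffunP => I.
  by rewrite !ffunE chiN_at // max_peak ?u1 ?u2 // subrr.
have := ecN (ec_TN sb); congr ec; apply/ffunP => I.
rewrite !ffunE chiN_at // (max_valley _ sb2 sb1) ?u1 ?u2 //; last exact: compat_mem.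
by rewrite addrAC subrr add0r.
Qed.

Lemma segment_chi_mod i j : (i < t)%N -> (a i < j < a i.+1)%N ->
  ec ((al i)%:R *: chiN j - (-1) ^+ i *: (ind (a i) - ind (a i.+1))).
Proof.
move=> it /andP[j1 j2].
have nE : a i.+1 = (a i + al i)%N := fence_aS alpha i.
have bn : (a i.+1 <= n.+1)%N by rewrite -fence_aN ?fence_a_le // ltnW.
(* [d k] is the drop of the indicator across the k-th edge of the segment; consecutive drops differ
   by a toggle. *)
have [d dE] : {d : nat -> fn | forall k, d k = ind (a i + k) - ind (a i + k).+1}.
  by exists (fun k => ind (a i + k) - ind (a i + k).+1).
have dT k : (0 < k < al i)%N -> ec (d k.-1 - d k).
  move=> /andP[k1 k2]; have hk : (0 < a i + k <= n)%N by lia.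
  have [u1 u2] := @up_interior alpha i (a i + k) it ltac:(lia).
  have := ec_TN hk; congr ec; apply/ffunP => I.
  have /andP[hk1 hk2] := hk.
  rewrite !dE !ffunE tau_chain ?u1 ?u2 //; last exact: compat_mem.
  have -> : (a i + k).-1 = (a i + k.-1)%N by lia.
  have -> : (a i + k.-1).+1 = (a i + k)%N by lia.
  ring.
have d0 k : (k < al i)%N -> ec (d k - d 0%N).
  elim: k => [|k IH] h; first by rewrite subrr; exact: ec0.
  have -> : d k.+1 - d 0%N = (d k - d 0%N) - (d k.+1.-1 - d k.+1).
    by rewrite succnK [RHS]addrC opprB addrA subrK.
  by apply: ecB; [apply: IH; lia | apply: dT].
have dS k : (k < al i)%N -> ec ((al i)%:R *: d k - (ind (a i) - ind (a i.+1))).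
  move=> h.
  (* The drops telescope to the difference at the ends, so the left side compares [d k] with each of
     the [al i] drops. *)
  have -> : (al i)%:R *: d k - (ind (a i) - ind (a i.+1)) =
    \sum_(m < al i) ((d k - d 0%N) - (d m - d 0%N)).
    under eq_bigr do rewrite opprB addrA subrK.
    rewrite sumrB sumr_const card_ord -scaler_nat; congr (_ - _).
    rewrite -[LHS]opprB -(big_mkord xpredT d).
    have := telescope_sumr (fun k => ind (a i + k)) (leq0n (al i)).
    rewrite addn0 -nE => <-; rewrite -sumrN; apply: eq_bigr => m _.
    by rewrite opprB dE addnS.
  by apply: ec_sum => m _; apply: ecB; apply: d0.
have jE : j = (a i + (j - a i))%N by lia.
have [u1 u2] := @up_interior alpha i j it ltac:(lia).
have jn : (0 < j <= n)%N by lia.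
have /andP[jn1 jn2] := jn.
(* [chi] is the drop on the edge going up from [x_j]: edge j when the segment ascends, edge j - 1
   with reversed sign when it descends. *)
have chiE : chiN j = if odd i then - d (j - a i).-1 else d (j - a i)%N.
  have -> : d (j - a i).-1 = ind j.-1 - ind j.
    by rewrite dE; congr (ind _ - ind _); lia.
  rewrite dE -jE; apply/ffunP => I.
  rewrite chiN_at // max_chain ?u1 ?u2 //; last exact: compat_mem.
  by case: (odd i); rewrite !ffunE //= opprB.
rewrite -signr_odd chiE; case: (odd i).
  have -> (X Y : fn) : (al i)%:R *: - X - (-1) ^+ true *: Y = - ((al i)%:R *: X - Y).
    by rewrite expr1 scalerN scaleN1r opprK opprB addrC.
  by apply/ecN/dS; lia.
by rewrite expr0 scale1r; apply: dS; lia.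
Qed.

Lemma BA_mem f : f \in BA alpha R -> exists i j,
  [/\ (i < t)%N, (a i < j < a i.+1)%N &
      f = (al i)%:R *: chiN j + chis i + chis i.+1].
Proof.
move=> /flatten_mapP[i]; rewrite mem_iota => /andP[i1 i2] /mapP[j].
case: i i1 i2 => // i _ i2; rewrite mem_iota /= => hj ->.
have it : (i < t)%N by move: i2; rewrite add1n.
exists i, j; split => //; rewrite fence_aS.
have {}hj : (a i < j < (a i).+1 + (al i).-1)%N := hj.
by have := alpha_pos alpha_gt0 it; lia.
Qed.

Lemma mem_BA i j : (i < t)%N -> (a i < j < a i.+1)%N ->
  (al i)%:R *: chiN j + chis i + chis i.+1 \in BA alpha R.
Proof.
move=> it hj; apply/flatten_mapP; exists i.+1; first by rewrite mem_iota; lia.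
have hj' : (a i < j < (a i).+1 + (al i).-1)%N by move: hj; rewrite fence_aS; lia.
by apply/mapP; exists j => //; rewrite mem_iota.
Qed.

Lemma ec_BA f : f \in BA alpha R -> ec f.
Proof.
move=> /BA_mem[i [j [it hj ->]]].
(* Exactly one of i and i + 1 is odd, so the end indicators cancel and the constant 1 remains in
   either parity. *)
have := ecD (ecD (ecD (segment_chi_mod it hj) (chis_mod (ltnW it))) (chis_mod it))
  (ec_cst 1).
congr ec; apply/ffunP => I; rewrite -signr_odd /=.
by case: (odd i); rewrite !ffunE /= ?expr0 ?expr1 /GRing.scale /=; ring.
Qed.

(** * Independence by dimension count, and the reverse inclusion *)

Lemma max_at_principal z j : (0 < z <= n)%N -> (0 < j <= n)%N ->
  max_at alpha (ext alpha (principal alpha true z)) j = (j == z).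
Proof.
move=> /andP[z0 zn] /andP[j0 jn].
have t0 : (0 < t)%N by apply: ltnW.
have en : ext alpha (principal alpha true z) n.+1 = ~~ up n.
  by rewrite /ext ltnn upn.
have eb k : (0 < k <= n)%N -> ext alpha (principal alpha true z) k = below alpha z k.
  by move=> /andP[k0 kn]; rewrite /ext gtn_eqF // kn /principal andbT.
have bz : below alpha z z by rewrite /below leqnn subnn.
rewrite /max_at eb ?j0 //; case: (ltngtP j z) => [jz|zj|->].
- rewrite (below_lt _ jz) eb; last by lia.
  by case: (up j); rewrite //=; case: (below _ _ _).
- have -> : below alpha z j = ~~ up j.-1 && below alpha z j.-1.
    by rewrite -{1}(prednK j0) below_ge // -ltnS prednK.
  rewrite (eb j.-1); last by lia.
  by case: (up j.-1); rewrite //=; case: (below _ _ _); rewrite ?andbF.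
- rewrite bz /=; apply/andP; split; apply/implyP => u.
    have [e|ne] := eqVneq z n; first by rewrite (_ : z.+1 = n.+1) ?en -?e ?u.
    rewrite eb; last by lia.
    by rewrite below_ge // u.
  have [e|ne] := eqVneq z 1%N; first by move: u; rewrite e up0.
  rewrite eb; last by lia.
  by rewrite below_lt ?(negPf u) //; lia.
Qed.

(** Evaluated at principal ideals the functions [chi] form an identity matrix, since such an ideal
    has a single maximal element. *)
Lemma chi_free : free [seq chi R q | q <- enum 'I_n].
Proof.
have -> : [seq chi R q | q <- enum 'I_n] = [tuple chi R q | q < n].
  by [].
have hn (q : 'I_n) : (0 < q.+1 <= n)%N by rewrite ltn_ord.
have maxE (q r : 'I_n) :
  max_at alpha (mem_ext (val (ideal_of (@compat_principal alpha true r.+1)))) q.+1 = (q == r).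
  by rewrite /max_at !mem_ideal_of -/(max_at alpha _ q.+1) max_at_principal.
apply: (introT (@freeP _ (Defs.fn alpha R) _ _)) => k hk i.
have := congr1 (fun f : fn => f (ideal_of (@compat_principal alpha true i.+1))) hk.
rewrite sum_ffunE !ffunE (bigD1 i) //= big1 ?addr0 => [|j ji].
  rewrite (nth_map i) ?size_enum_ord // nth_ord_enum ffunE chiE //.
  by rewrite maxE eqxx => h; rewrite -[LHS]mulr1.
rewrite (nth_map i) ?size_enum_ord // nth_ord_enum ffunE chiE //.
rewrite maxE (negPf ji); exact: mulr0.
Qed.

Definition shared_chis : seq fn := mkseq (fun i => chis i.+1) t.-1.

Lemma chis_span k : chis k \in <<shared_chis>>%VS.
Proof.
have [/andP[k0 kt]|h] := boolP (0 < k < t)%N.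
  apply/memv_span/mapP; exists k.-1; last by rewrite prednK.
  by rewrite mem_iota; lia.
by rewrite /Defs.chis (negPf h) mem0v.
Qed.

Lemma shared_chis_coord v : v \in <<shared_chis>>%VS ->
  exists b : nat -> R, v = \sum_(i < t.-1) b i *: chis i.+1.
Proof.
move=> /(coord_span (X := in_tuple shared_chis)) hv.
pose b (i : nat) : R :=
  if (insub i : option 'I_(size shared_chis)) is Some k
  then coord (in_tuple shared_chis) k v else 0.
exists b.
rewrite -(big_mkord xpredT (fun i => b i *: chis i.+1)).
rewrite [LHS]hv -(size_mkseq (fun i => chis i.+1) t.-1) big_mkord.
apply: eq_bigr => k _; rewrite /b valK; congr (_ *: _).
by rewrite nth_mkseq // -(size_mkseq (fun i => chis i.+1) t.-1).
Qed.

(** For non-shared x, the basis element at x is solved for [chi_x], dividing by the segment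
    length. *)
Lemma chi_span : (<<[seq chi R q | q <- enum 'I_n]>> <= <<BA alpha R>> + <<shared_chis>>)%VS.
Proof.
apply/span_subvP => f /mapP[q _ ->]; rewrite -chiNE.
have [i it /andP[i1 i2]] : exists2 i, (i < t)%N & (a i <= q.+1 < a i.+1)%N.
  by apply: segment_exists; rewrite fence_aN ?ltnS ?ltn_ord // ltnW.
have shS k : chis k \in (<<BA alpha R>> + <<shared_chis>>)%VS.
  exact: subvP (addvSr _ _) _ (chis_span k).
move: i1; rewrite leq_eqVlt => /orP[/eqP e|i1].
  have -> : chiN q.+1 = chis i; last exact: shS.
  by rewrite /Defs.chis it -e; case: i e {i2 it} => //; rewrite fence_a0.
have hB := mem_BA it (introT andP (conj i1 i2)).
have al0 : (al i)%:R != 0 :> R by rewrite pnatr_eq0 -lt0n alpha_pos.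
rewrite -[chiN _]scale1r -(mulVf al0) -scalerA; apply: memvZ.
rewrite -[_ *: _](addrK (chis i + chis i.+1)); apply: memvB; last exact: memvD.
by rewrite addrA; apply: subvP (addvSl _ _) _ (memv_span hB).
Qed.

Lemma BA_span : (<<BA alpha R>> <= <<[seq chi R q | q <- enum 'I_n]>>)%VS.
Proof.
have hN j : chiN j \in <<[seq chi R q | q <- enum 'I_n]>>%VS.
  rewrite /Defs.chiN; case: insubP => [q _ _|]; last by rewrite mem0v.
  by case: ifP; rewrite ?mem0v // memv_span // map_f // mem_enum.
have hs i : chis i \in <<[seq chi R q | q <- enum 'I_n]>>%VS.
  by rewrite /Defs.chis; case: ifP; rewrite ?mem0v.
apply/span_subvP => f /BA_mem[i [j [_ _ ->]]].
by rewrite !memvD // memvZ.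
Qed.

Lemma size_BA : size (BA alpha R) = (\sum_(b <- alpha) (b - 1))%N.
Proof.
rewrite size_flatten /shape -map_comp sumnE big_map.
rewrite (iotaDl 1%N 0%N t : iota 1 t = _) big_map [in RHS](big_nth 0%N) /index_iota subn0.
by apply: eq_bigr => i _; rewrite /= size_map size_iota subn1.
Qed.

(** The n independent functions [chi] lie in a space spanned by [BA] and t - 1 shared functions, n
    vectors in all; hence no vector of [BA] is redundant. *)
Lemma dim_BA : \dim <<BA alpha R>> = size (BA alpha R).
Proof.
apply/eqP; rewrite eqn_leq dim_span /=.
have := dimvS chi_span; have := chi_free; rewrite /free => /eqP ->.
rewrite size_map size_enum_ord => h1.
have h2 := leq_of_leqif (dimv_add_leqif <<BA alpha R>> <<shared_chis>>).
have := dim_span shared_chis; rewrite size_mkseq => h3.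
have := sum_pred_alpha alpha_gt0; rewrite -size_BA fence_aN //; last exact: ltnW.
have t0 : (0 < t)%N by apply: ltnW.
by move: h1 h2 h3 t0; lia.
Qed.

Lemma ec_shared_chis v : v \in <<shared_chis>>%VS -> ec v -> v = 0.
Proof.
move=> /shared_chis_coord[b hv]; rewrite hv => hec.
(* At a valley [chi] is a constant minus the indicator, modulo toggles, which flips the sign of the
   coefficient. *)
pose b' i := if odd i.+1 then b i else - b i.
have [c [cq rel]] : ec (\sum_(i < t.-1) b' i *: ind (a i.+1)).
  have -> : \sum_(i < t.-1) b' i *: ind (a i.+1) =
    \sum_(i < t.-1) b i *: chis i.+1 -
    \sum_(i < t.-1) (b i *: (chis i.+1 - (if odd i.+1 then ind (a i.+1)
                                        else cst 1 - ind (a i.+1))) +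
                    (if odd i.+1 then 0 else b i *: cst 1)).
    rewrite -sumrB; apply: eq_bigr => i _; rewrite /b'.
    case: ifP => _; rewrite !scalerBr ?addr0 ?scalerBr ?scaleNr.
      by rewrite opprB addrC subrK.
    by apply/ffunP => I; rewrite !ffunE /GRing.scale /=; ring.
  apply: ecB => //; apply: ec_sum => i _; apply: ecD.
    by apply/ecZ/chis_mod; have := ltn_ord i; lia.
  by case: ifP => _; [exact: ec0 | exact/ecZ/ec_cst].
apply: big1 => i _.
have := relation_trivial alpha_gt0 t_ge2 alpha_head alpha_last rel i.
rewrite /b'; case: ifP => _; first by move=> ->; rewrite scale0r.
by move/eqP; rewrite oppr_eq0 => /eqP ->; rewrite scale0r.
Qed.

(** Given f in [A_T], split off its part in the span of [BA]; the remainder is a shared combination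
    still in [A_T], hence zero by [ec_shared_chis]. *)
Lemma span_BA_AT f : f \in <<BA alpha R>>%VS <-> in_AT f.
Proof.
have ecS u : u \in <<BA alpha R>>%VS -> ec u.
  move=> /(coord_span (X := in_tuple (BA alpha R))) ->.
  by apply: ec_sum => i _; apply/ecZ/ec_BA/mem_nth.
split=> [fB|[fX fec]]; first by split; [exact: subvP BA_span _ fB | exact: ecS].
have /memv_addP[u uB [v vS fE]] := subvP chi_span _ fX.
suff -> : f = u by [].
rewrite fE (ec_shared_chis vS) ?addr0 //.
have -> : v = f - u by rewrite fE addrC addKr.
by apply: ecB => //; exact: ecS.
Qed.

End Main.

Theorem theorem3p5 (R : realType) (alpha : seq nat) :
  (2 <= size alpha)%N ->
  all (fun a => 0 < a)%N alpha ->
  (2 <= head 0 alpha)%N -> (2 <= last 0 alpha)%N ->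
  [/\ free (BA alpha R),
      (forall f : fn alpha R, f \in <<BA alpha R>>%VS <-> in_AT f)
    & \dim <<BA alpha R>>%VS = (\sum_(a <- alpha) (a - 1))%N].
Proof.
move=> t_ge2 alpha_gt0 alpha_head alpha_last; split.
- by rewrite /free dim_BA.
- exact: span_BA_AT.
- by rewrite dim_BA // size_BA.
Qed.
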